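(* Let $G$ be a finitely generated virtually abelian group. Then every conjugacy class of $G$ has polynomial growth in $G$.
   Context: A group is virtually abelian if it has a finite-index abelian subgroup. Let $G$ be a group with a choice of finite generating set $S$. For $g \in G$, $\ell_S(g)$ is the minimal length of a word over $S \cup S^{-1}$ (including the empty word) representing $g$. For a subset $U \subseteq G$, the growth of $U$ in $G$ is the function $\beta_{U,S}(n) = |\{g \in U : \ell_S(g) \leq n\}|$, written $\beta_U(n)$ when $S$ is understood. For functions $f,g \colon \mathbb{N} \to \mathbb{N}$ write $f \preccurlyeq g$ if there exists $\lambda \geq 1$ such that $f(n) \leq \lambda g(\lambda n + \lambda) + \lambda$ for all $n \in \mathbb{N}$, and write $f \sim g$ (the functions are equivalent) if $f \preccurlyeq g$ and $g \preccurlyeq f$. Up to equivalence, the growth of a subset $U$ in $G$ does not depend on the choice of finite generating set for $G$. A subset $U$ has polynomial growth in $G$ if $\beta_U(n) \sim n^d$ for some positive integer $d$. The conjugacy class of $g \in G$ is $\{hgh^{-1} : h \in G\}$.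
   Formalization: The degree d may be 0 rather than only a positive integer, since finite conjugacy classes such as that of the identity have bounded growth, not equivalent to n^d for any d ≥ 1; for infinite classes d is automatically positive. *)

(* Defs.v *)
From HB Require Import structures.
From mathcomp Require Export all_boot.
From mathcomp Require Export finmap.
From mathcomp Require Export boolp classical_sets functions cardinality.

Set Implicit Arguments.
Unset Strict Implicit.
Unset Printing Implicit Defensive.

Local Open Scope classical_set_scope.
Local Open Scope group_scope.

Definition left_cosets (G : groupType) (A : set G) : set (set G) :=
  range (fun g => [set g * a | a in A]).

Definition virtually_abelian (G : groupType) : Prop :=
  exists A : set G, [/\ group_closed (mem A),
                        {in A &, forall x y, commute x y} &
                        finite_set (left_cosets A)].

Definition letters (G : groupType) (S : set G) : set G :=
  S `|` [set s^-1 | s in S].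

Definition has_word (G : groupType) (S : set G) (g : G) (k : nat) : Prop :=
  exists w : seq G,
    [/\ forall x, x \in w -> letters S x, size w = k & \prod_(x <- w) x = g].

Definition generates (G : groupType) (S : set G) : Prop :=
  forall g : G, exists k, has_word S g k.

(* The value 0 of the second branch is never used when S generates G. *)
Definition word_length (G : groupType) (S : set G) (g : G) : nat :=
  if pselect (exists k, `[< has_word S g k >]) is left ex then ex_minn ex
  else 0%N.

(* fset_set is meaningful on finite sets only: balls are finite as soon as S
   is a finite generating set (see finite_ball below). *)
Definition growth (G : groupType) (S U : set G) (n : nat) : nat :=
  #|` fset_set [set g : G | U g /\ (word_length S g <= n)%N] |.

Definition growth_le (f g : nat -> nat) : Prop :=
  exists2 l : nat, (1 <= l)%N & forall n, (f n <= l * g (l * n + l) + l)%N.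

Definition growth_equiv (f g : nat -> nat) : Prop :=
  growth_le f g /\ growth_le g f.

(* The degree 0 is allowed: a finite nonempty subset, such as the conjugacy
   class of 1, has bounded growth, equivalent to n ^ 0 and to no n ^ d with
   0 < d.  An infinite subset always has positive degree, see
   infinite_growth_degree_gt0 below. *)
Definition polynomial_growth (G : groupType) (S U : set G) : Prop :=
  exists d : nat, growth_equiv (growth S U) (fun n => n ^ d)%N.

Definition conjugacy_class (G : groupType) (g : G) : set G :=
  range (fun h : G => h * g * h^-1).

Lemma word_lengthP (G : groupType) (S : set G) (g : G) :
  generates S -> has_word S g (word_length S g).
Proof.
move=> /(_ g)[k kP]; rewrite /word_length; case: pselect => [ex|[]].
  by case: ex_minnP => m /asboolP.
by exists k; apply/asboolP.
Qed.

Lemma word_length_le (G : groupType) (S : set G) (g : G) k :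
  has_word S g k -> (word_length S g <= k)%N.
Proof.
move=> kP; rewrite /word_length; case: pselect => // ex.
by case: ex_minnP => m _; apply; apply/asboolP.
Qed.

Lemma finite_ball (G : groupType) (S : set G) (n : nat) :
  finite_set S -> generates S ->
  finite_set [set g : G | (word_length S g <= n)%N].
Proof.
move=> finS genS.
have finL : finite_set (letters S).
  by rewrite finite_setU; split=> //; apply: finite_image.
have finW k : finite_set [set g | has_word S g k].
  elim: k => [|k IHk].
    apply: (@sub_finite_set _ _ [set 1]); last exact: finite_set1.
    by move=> g [[|a w] [_ //= _ <-]]; rewrite big_nil.
  apply: (@sub_finite_set _ _
      [set x.1 * x.2 | x in letters S `*` [set g | has_word S g k]]).
    move=> g [[|a w] [wS //= [szw] <-]].
    exists (a, \prod_(x <- w) x) => /=; last by rewrite big_cons.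
    split=> /=; first by apply: wS; rewrite mem_head.
    by exists w; split=> // x xw; apply: wS; rewrite inE xw orbT.
  exact/finite_image/finite_setX.
apply: (@sub_finite_set _ _ (\bigcup_(k in `I_n.+1) [set g | has_word S g k])).
  by move=> g /= gn; exists (word_length S g); [|apply: word_lengthP].
by apply: bigcup_finite => // ; apply: finite_II.
Qed.

Lemma infinite_growth_degree_gt0 (G : groupType) (S U : set G) (d : nat) :
  finite_set S -> generates S -> infinite_set U ->
  growth_equiv (growth S U) (fun n => n ^ d)%N -> (0 < d)%N.
Proof.
move=> finS genS infU [[l _ lP] _]; rewrite lt0n; apply/eqP => d0.
have [X XU Xl] := infinite_set_fset (l + l).+1 infU.
pose n := \max_(x <- X) word_length S x.
have := lP n; rewrite d0 expn0 muln1 leqNgt => /negP; apply.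
apply: leq_trans Xl _; apply: fsubset_leq_card.
apply/fsubsetP => x xX; rewrite in_fset_set; last first.
  by apply: sub_finite_set (finite_ball n finS genS) => g [].
by rewrite inE; split; [apply: XU | apply: leq_bigmax_seq].
Qed.

(* Main.v *)
From HB Require Import structures.
Require Import Defs.
From mathcomp Require Import all_order all_algebra zify.

(** Let A be an abelian subgroup of finite index and g an element of G.  For
    the elements a of A such that g a g^-1 is again in A, the conjugate
    a g a^-1 equals z g, where z = a (g a g^-1)^-1 depends additively on a.
    These a form a subgroup of finite index, so the conjugacy class of g is the
    union of finitely many conjugates of the coset B g, where B is the subgroup
    of A formed by the elements z ([conjugacy_class_cover]); moreover B g itself
    lies in the class ([twisted_difference_conj]).  Multiplications by fixed
    elements change the word length by a bounded amount, so it suffices to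
    count the elements of B that have length at most n in G.

    By Schreier's argument there is a homomorphism f from some Z^m to A such
    that each element of A of length at most n is the image of a vector with
    entries at most n + 1 ([schreier_coordinates]).  Everything then takes place
    in Z^m, with the lattices K = ker f and W = f^-1(B); the degree of the
    growth is d = rank W - rank K ([subgroup_rank]).  Linear algebra over the
    rationals gives independent families k in K and b in W (with d vectors in
    b) such that N w, for one fixed positive integer N, is an integer
    combination of k and b whose coefficients depend linearly on w in W
    ([adapted_basis]).

    Upper bound: f w is determined by the coefficients on b, which grow at most
    linearly with w, and by the coefficients on k modulo N, since changing the
    latter by multiples of N moves w inside K.  Hence O(n^d) values of f w in B
    come from vectors of size at most n.  Lower bound: the combinations of
    the d elements f(b_i) with coefficients from 0 to n are pairwise distinct
    and have length O(n) in G ([word_length_comb]). *)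

Set Implicit Arguments.
Unset Strict Implicit.
Unset Printing Implicit Defensive.

Import Order.TTheory GRing.Theory Num.Theory.

Local Open Scope classical_set_scope.
Local Open Scope ring_scope.

(** * Sublattices of Z^m *)

Local Notation toQ := (map_mx (intr : int -> rat)).

Lemma clear_denominators (m n : nat) (P : 'M[rat]_(m, n)) :
  exists N : nat, exists P' : 'M[int]_(m, n), toQ P' = N.+1%:R *: P.
Proof.
pose D (ij : 'I_m * 'I_n) := `|denq (P ij.1 ij.2)|%N.
have D_gt0 ij : (0 < D ij)%N by rewrite /D absz_gt0 denq_neq0.
have [N ND] : exists N, (\prod_ij D ij)%N = N.+1.
  by exists (\prod_ij D ij)%N.-1; rewrite prednK // prodn_gt0.
exists N, (\matrix_(i, j)
  (numq (P i j) * (\prod_(kl | kl != (i, j)) D kl)%N%:Z)).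
apply/matrixP => i j; rewrite !mxE -ND.
rewrite [in RHS](bigD1 (i, j)) //= natrM rmorphM /=.
have -> : (D (i, j))%:R = (denq (P i j))%:~R :> rat.
  by rewrite /D pmulrn gez0_abs // denq_ge0.
rewrite pmulrn mulrAC; congr (_ * _).
by rewrite numqE mulrC.
Qed.

(** Independence is tested over the rationals, where ranks are available, while
    the new vectors are still taken in [X]: a family [b] of maximal size works,
    because a vector of [X] outside the span could be appended to it. *)
Lemma extend_to_maximal_free (m r : nat) (X : set 'rV[int]_m)
    (V : 'M[int]_(r, m)) :
  row_free (toQ V) ->
  exists d, exists b : 'M[int]_(d, m),
    [/\ forall i, X (row i b), row_free (toQ (col_mx V b)) &
        forall x, X x -> (toQ x <= toQ (col_mx V b))%MS].
Proof.
move=> freeV.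
pose P d := `[< exists b : 'M[int]_(d, m),
  (forall i, X (row i b)) /\ row_free (toQ (col_mx V b)) >].
have exP : exists d, P d.
  exists 0%N; apply/asboolP; exists 0; split=> [[]//|].
  rewrite /row_free map_col_mx -addsmxE (_ : toQ 0 = 0) ?map_mx0 //.
  by rewrite addsmx0 addn0.
have ubP d : P d -> (d <= m)%N.
  case/asboolP=> b [_ /eqP rk]; have := rank_leq_col (toQ (col_mx V b)).
  by rewrite rk; apply: leq_trans; apply: leq_addl.
case: (ex_maxnP exP ubP) => d /asboolP[b [Xb freeb]] maxd.
exists d, b; split=> // x Xx; apply: contrapT => /negP xVb.
suff /maxd : P (d + 1)%N by rewrite addn1 ltnn.
apply/asboolP; exists (col_mx b x); split.
  move=> i; case: (split_ordP i) => j ->; rewrite ?rowKu ?rowKd //.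
  by rewrite (_ : row j x = x) //; apply/rowP => k; rewrite mxE ord1.
have nrV : ~~ (toQ x <= toQ V + toQ b)%MS by rewrite addsmxE -map_col_mx.
rewrite /row_free !map_col_mx -addsmxE -[X in X == _]/(\rank _).
rewrite -(adds_eqmx (eqmx_refl _) (addsmxE _ _)) addsmxA.
move: freeb; rewrite /row_free map_col_mx -addsmxE => /eqP rkb.
have rkx : \rank (toQ x) = 1%N.
  apply/eqP; rewrite eqn_leq rank_leq_row lt0n mxrank_eq0.
  by apply: contraNneq nrV => ->; apply: sub0mx.
have cap0 : ((toQ V + toQ b) :&: toQ x)%MS = 0.
  apply/eqP; apply: contraNT nrV => cap.
  apply: submx_trans (capmxSl _ (toQ x)).
  rewrite -(geq_leqif (mxrank_leqif_sup (capmxSr _ _))) rkx.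
  by rewrite lt0n mxrank_eq0.
have := mxrank_sum_cap (toQ V + toQ b)%MS (toQ x).
by rewrite cap0 mxrank0 addn0 rkb rkx addnA => ->.
Qed.

Lemma toQ_inj (m n : nat) : injective (fun M : 'M[int]_(m, n) => toQ M).
Proof.
move=> M M' /matrixP eqM; apply/matrixP => i j.
by have := eqM i j; rewrite !mxE => /intr_inj.
Qed.

(** [k] is a maximal independent family in [K] and [b] completes it to one in
    [W].  The rows of [b] are independent modulo [K], as an element of [K] is a
    rational combination of [k].  The coordinates of [w] are
    [w *m pinvmx (col_mx k b)]; the matrix [P] is this pseudo-inverse
    multiplied by a common denominator [N.+1]. *)
Lemma adapted_basis (m : nat) (K W : set 'rV[int]_m) :
  exists r d N,
  exists k : 'M[int]_(r, m), exists b : 'M[int]_(d, m),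
  exists P : 'M[int]_(m, r + d),
  [/\ forall i, K (row i k), forall i, W (row i b),
      forall c : 'rV_d, K (c *m b) -> c = 0 &
      forall w, W w -> w *+ N.+1 = w *m P *m col_mx k b].
Proof.
(* Extending the empty family gives k. *)
have [|r [k [Kk freek kK]]] := @extend_to_maximal_free m 0 K 0.
  by rewrite /row_free -leqn0 rank_leq_row.
have eqk : (toQ (col_mx (0 : 'M_(0, m)) k) :=: toQ k)%MS.
  rewrite map_col_mx [toQ (0 : 'M_(0, m))]flatmx0.
  exact: eqmx_trans (eqmx_sym (addsmxE _ _)) (adds0mx _ _).
move: freek; rewrite /row_free eqk => freek.
have [d [b [Wb freekb Wkb]]] := extend_to_maximal_free W freek.
have [N [P PN]] := clear_denominators (pinvmx (toQ (col_mx k b))).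
exists r, d, N, k, b, P; split=> //.
- move=> c /kK; rewrite eqk => /submxP[q qk].
  have : row_mx (- q) (toQ c) *m toQ (col_mx k b) = 0.
    by rewrite map_col_mx mul_row_col mulNmx -qk map_mxM addNr.
  rewrite -(mul0mx _ (toQ (col_mx k b))) => /(row_free_inj freekb).
  rewrite -row_mx0 => /eq_row_mx[_ c0].
  by apply: toQ_inj; rewrite c0 map_mx0.
- move=> w /Wkb /mulmxKpV wE.
  apply: toQ_inj; rewrite !map_mxM PN -scalemxAr -scalemxAl wE.
  by rewrite raddfMn scaler_nat.
Qed.

Lemma leq_exp_base (m n e : nat) : (m <= n)%N -> (m ^ e <= n ^ e)%N.
Proof. by case: e => // e mn; rewrite leq_exp2r. Qed.

Lemma bounded_coordinates (m p : nat) (P : 'M[int]_(m, p)) :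
  exists M : nat, forall n (w : 'rV[int]_m),
    (forall i, `|w 0 i| <= n%:Z) -> forall j, `|(w *m P) 0 j| <= (M * n)%:Z.
Proof.
exists (\sum_i \sum_j `|P i j|)%N => n w wn j.
rewrite mxE (le_trans (ler_norm_sum _ _ _)) // PoszM.
rewrite (big_morph Posz PoszD (erefl 0%:Z)) mulr_suml ler_sum // => i _.
rewrite normrM mulrC ler_pM // -abszE lez_nat (bigD1 j) //=; exact: leq_addr.
Qed.

(** The number [d] is the rank of the image of [f] intersected with [B].  The
    upper bound is stated as a covering by an explicit list [Y], so that the
    cover of a union of translates is obtained by concatenation. *)
Lemma subgroup_rank (A : zmodType) (m : nat) (f : {additive 'rV[int]_m -> A})
    (B : set A) : (forall x y, B x -> B y -> B (x - y)) ->
  exists d : nat,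
  (exists b : 'I_d -> A, (forall i, B (b i)) /\
    injective (fun c : {ffun 'I_d -> nat} => \sum_i b i *+ c i)) /\
  (exists C : nat, forall n, exists2 Y : seq A, (size Y <= C * n.+1 ^ d)%N &
    forall w : 'rV[int]_m,
      (forall i, `|w 0 i| <= n%:Z) -> B (f w) -> f w \in Y).
Proof.
move=> BB.
have [r [d [N [k [b [P [Kk Bb freeb spanP]]]]]]] :=
  adapted_basis [set w | f w = 0] (f @^-1` B).
have fsum n (c : 'rV_n) (M : 'M[int]_(n, m)) :
    f (c *m M) = \sum_i f (row i M) *~ c 0 i.
  rewrite mulmx_sum_row raddf_sum; apply: eq_bigr => i _.
  by rewrite -raddfMz -scaler_int intz.
exists d; split.
  exists (fun i => f (row i b)); split=> // c c' eqc.
  have /freeb/rowP c0 : f ((\row_i ((c i)%:Z - (c' i)%:Z)) *m b) = 0.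
    rewrite fsum; under eq_bigr do rewrite mxE mulrzBr -!pmulrn.
    by rewrite sumrB eqc subrr.
  by apply/ffunP => i; move: (c0 i); rewrite !mxE => /subr0_eq [].
have [M PM] := bounded_coordinates P.
exists (N.+1 ^ r * (2 * M).+1 ^ d)%N => n.
(* The code of w records the coordinates of N.+1 * w on k modulo N.+1, and its
   coordinates on b, which lie between - M n and M n, shifted by M n. *)
pose code (w : 'rV[int]_m) :
    {ffun 'I_r -> 'I_N.+1} * {ffun 'I_d -> 'I_(2 * (M * n)).+1} :=
  ([ffun j => inord (absz (modz ((w *m P) 0 (lshift d j)) N.+1%:Z))],
   [ffun j => inord (absz ((w *m P) 0 (rshift r j) + (M * n)%:Z))]).
pose box (w : 'rV[int]_m) := (forall i, `|w 0 i| <= n%:Z) /\ B (f w).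
have code_inj w w' : box w -> box w' -> code w = code w' -> f w = f w'.
  move=> [wn Bw] [w'n Bw'] [/ffunP eqK /ffunP eqb].
  apply/eqP; rewrite -subr_eq0 -raddfB; apply/eqP.
  pose c := (w - w') *m P.
  have cE i : c 0 i = (w *m P) 0 i - (w' *m P) 0 i by rewrite /c mulmxBl !mxE.
  have cb : rsubmx c = 0.
    apply/rowP => j; rewrite [LHS]mxE cE [RHS]mxE.
    have := eqb j; rewrite !ffunE => /(congr1 val).
    move: (PM _ _ wn (rshift r j)) (PM _ _ w'n (rshift r j)).
    move: ((w *m P) 0 _) ((w' *m P) 0 _) => x y xn yn.
    by rewrite /= !inordK; lia.
  (* The coordinates on k differ by a multiple of N.+1, so w - w' is an integer
     combination of k. *)
  pose z : 'rV[int]_r := \row_j divz (c 0 (lshift d j)) N.+1%:Z.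
  have cz : lsubmx c = z *+ N.+1.
    apply/rowP => j; rewrite -scaler_nat [LHS]mxE [RHS]mxE [z 0 j]mxE cE.
    have := eqK j; rewrite !ffunE => /(congr1 val).
    move: ((w *m P) 0 _) ((w' *m P) 0 _) => x y.
    have modlt (t : int) : (`|(t %% N.+1%:Z)%Z| < N.+1)%N.
      by rewrite -ltz_nat gez0_abs ?modz_ge0 ?ltz_pmod.
    rewrite /= !inordK // => /(congr1 Posz).
    rewrite !gez0_abs ?modz_ge0 // => /eqP; rewrite eqz_mod_dvd => dvd_xy.
    by rewrite natz mulrC divzK.
  have Bww' : B (f (w - w')) by rewrite raddfB; apply: BB.
  have := spanP _ Bww'; rewrite -/c -[c]hsubmxK mul_row_col cb mul0mx addr0 cz.
  have -> : z *+ N.+1 *m k = (z *m k) *+ N.+1 by rewrite -!scaler_nat scalemxAl.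
  move=> eqz; have -> : w - w' = z *m k.
    apply/rowP => j; move/rowP/(_ j): eqz.
    rewrite -!scaler_nat [LHS]mxE [RHS]mxE.
    by apply: mulfI; rewrite pnatr_eq0.
  by rewrite fsum big1 // => i _; rewrite Kk mul0rz.
(* One representative for each code suffices. *)
exists [seq f (xget 0 [set w | box w /\ code w = c]) | c : _]; last first.
  move=> w wn Bw; apply/fintype.imageP; exists (code w) => //.
  have [boxg codeg] : [set w' | box w' /\ code w' = code w]
      (xget 0 [set w' | box w' /\ code w' = code w]) by apply: (@xgetI _ _ _ w).
  by apply: code_inj => //.
rewrite size_image card_prod !card_ffun !card_ord -mulnA leq_mul2l -expnMn.
by apply/orP; right; apply: leq_exp_base; lia.
Qed.

(** * Abelian subgroups as Z-modules *)

Record abelian_subgroup (G : groupType) := AbelianSubgroup {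
  carrier :> set G;
  carrier_group : group_closed (mem carrier);
  carrier_commute : {in carrier &, forall x y, commute x y} }.

(** The abelian subgroup, written additively: this makes the theory of modules
    over the integers available for it. *)
Definition elements (G : groupType) (A : abelian_subgroup G) :=
  {x : G | x \in carrier A}.

HB.instance Definition _ (G : groupType) (A : abelian_subgroup G) :=
  Choice.copy (elements A) {x : G | x \in carrier A}.

Definition elements_zero (G : groupType) (A : abelian_subgroup G) :
  elements A := exist _ 1%g (carrier_group A).1.

Definition elements_opp (G : groupType) (A : abelian_subgroup G)
    (x : elements A) : elements A :=
  exist _ (sval x)^-1%g (group_closedV (carrier_group A) (svalP x)).

Definition elements_add (G : groupType) (A : abelian_subgroup G)
    (x y : elements A) : elements A :=
  exist _ (sval x * sval y)%g
    (group_closedM (carrier_group A) (svalP x) (svalP y)).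

Lemma elements_addA (G : groupType) (A : abelian_subgroup G) :
  associative (@elements_add G A).
Proof. by move=> x y z; apply: val_inj; apply: mulgA. Qed.

Lemma elements_addC (G : groupType) (A : abelian_subgroup G) :
  commutative (@elements_add G A).
Proof.
by move=> [x xA] [y yA]; apply: val_inj; apply: (carrier_commute xA yA).
Qed.

Lemma elements_add0 (G : groupType) (A : abelian_subgroup G) :
  left_id (elements_zero A) (@elements_add G A).
Proof. by move=> x; apply: val_inj; apply: mul1g. Qed.

Lemma elements_addN (G : groupType) (A : abelian_subgroup G) :
  left_inverse (elements_zero A) (@elements_opp G A) (@elements_add G A).
Proof. by move=> x; apply: val_inj; apply: mulVg. Qed.

HB.instance Definition _ (G : groupType) (A : abelian_subgroup G) :=
  GRing.isZmodule.Build (elements A) (@elements_addA G A) (@elements_addC G A)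
    (@elements_add0 G A) (@elements_addN G A).

Definition incl (G : groupType) (A : abelian_subgroup G) (z : elements A) : G :=
  sval z.

Lemma incl_inj (G : groupType) (A : abelian_subgroup G) :
  injective (@incl G A).
Proof. exact: val_inj. Qed.

Lemma incl0 (G : groupType) (A : abelian_subgroup G) :
  incl (0 : elements A) = 1%g.
Proof. by []. Qed.

Lemma inclD (G : groupType) (A : abelian_subgroup G) (x y : elements A) :
  incl (x + y) = (incl x * incl y)%g.
Proof. by []. Qed.

Lemma inclB (G : groupType) (A : abelian_subgroup G) (x y : elements A) :
  incl (x - y) = (incl x / incl y)%g.
Proof. by []. Qed.

Lemma incl_surj (G : groupType) (A : abelian_subgroup G) (x : G) :
  carrier A x -> exists z : elements A, incl z = x.
Proof. by move/mem_set => xA; exists (exist _ x xA). Qed.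

Definition int_comb (Z : zmodType) (m : nat) (t : 'I_m -> Z)
  (w : 'rV[int]_m) : Z := \sum_i t i *~ w 0 i.

Lemma int_comb_is_zmod_morphism (Z : zmodType) (m : nat) (t : 'I_m -> Z) :
  zmod_morphism (int_comb t).
Proof.
move=> v w; rewrite /int_comb -sumrB; apply: eq_bigr => i _.
by rewrite !mxE mulrzBr.
Qed.

HB.instance Definition _ (Z : zmodType) (m : nat) (t : 'I_m -> Z) :=
  GRing.isZmodMorphism.Build 'rV[int]_m Z (int_comb t)
    (int_comb_is_zmod_morphism t).

Lemma int_comb_delta (Z : zmodType) (m : nat) (t : 'I_m -> Z) (i : 'I_m) :
  int_comb t (delta_mx 0 i) = t i.
Proof.
rewrite /int_comb (bigD1 i) //= mxE !eqxx big1 ?addr0 // => j ji.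
by rewrite mxE (negPf ji) andbF.
Qed.

Local Open Scope group_scope.

(** * Subgroups of finite index *)

Lemma subgroup_mem1 (G : groupType) (H : set G) : group_closed (mem H) -> H 1.
Proof. by move=> groupH; apply/set_mem/groupH.1. Qed.

Lemma subgroup_memV (G : groupType) (H : set G) (x : G) :
  group_closed (mem H) -> H x -> H x^-1.
Proof.
by move=> groupH /mem_set Hx; apply/set_mem/(group_closedV groupH Hx).
Qed.

Lemma subgroup_memM (G : groupType) (H : set G) (x y : G) :
  group_closed (mem H) -> H x -> H y -> H (x * y).
Proof.
move=> groupH /mem_set Hx /mem_set Hy.
exact/set_mem/(group_closedM groupH Hx Hy).
Qed.

Definition finite_index (G : groupType) (A : set G) :=
  exists R : seq G, forall x, exists2 r, r \in R & A (r^-1 * x).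

Lemma finite_left_cosets_index (G : groupType) (A : set G) :
  group_closed (mem A) -> finite_set (left_cosets A) -> finite_index A.
Proof.
move=> groupA /finite_seqP[s sE]; exists (map (xget 1) s) => x.
pose C := [set x * a | a in A].
have : C \in s.
  by have /(congr1 (@^~ C)) /= <- := sE; exists x.
move=> Cs; exists (xget 1 C); first exact: map_f.
have [a Aa <-] : C (xget 1 C).
  by apply: (@xgetI _ _ _ x); exists 1; rewrite ?mulg1 //; apply: subgroup_mem1.
by rewrite invgM -mulgA mulVg mulg1; apply: subgroup_memV.
Qed.

Lemma finite_index_conj (G : groupType) (A : set G) (g : G) :
  finite_index A -> finite_index [set x | A (g * x * g^-1)].
Proof.
case=> R RP; exists [seq g^-1 * r * g | r <- R] => x.
have [r rR Ar] := RP (g * x * g^-1); exists (g^-1 * r * g); first exact: map_f.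
by move: Ar; rewrite /= !invgM invgK !mulgA mulgV mul1g.
Qed.

(** If [x] and [y] lie in the same coset [rA] and in the same coset [r'A'], then
    [y^-1 * x] lies in both subgroups: one element of each nonempty intersection
    of cosets is enough. *)
Lemma finite_indexI (G : groupType) (A A' : set G) :
  group_closed (mem A) -> group_closed (mem A') ->
  finite_index A -> finite_index A' -> finite_index (A `&` A').
Proof.
move=> groupA groupA' [R RP] [R' RP'].
pose C r r' := [set y | A (r^-1 * y) /\ A' (r'^-1 * y)].
exists [seq xget 1 (C r r') | r <- R, r' <- R'] => x.
have [[r rR Ar] [r' rR' Ar']] := (RP x, RP' x).
exists (xget 1 (C r r')); first exact: allpairs_f.
have [] : C r r' (xget 1 (C r r')) by apply: (@xgetI _ _ _ x).
move: (xget _ _) => y Ay Ay'.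
have quo (H : set G) q : group_closed (mem H) -> H (q^-1 * y) -> H (q^-1 * x) ->
    H (y^-1 * x).
  move=> groupH Hy Hx; have -> : y^-1 * x = (q^-1 * y)^-1 * (q^-1 * x).
    by rewrite invgM invgK -mulgA mulVKg.
  exact: subgroup_memM groupH (subgroup_memV groupH Hy) Hx.
by split; [apply: (quo A r) | apply: (quo A' r')].
Qed.

(** Schreier's argument: with coset representatives [r_j], the word
    [s_1 ... s_k] is the product of the factors [r_(j-1)^-1 s_j r_j] and of
    [r_k^-1], where [r_j] represents the coset of the tail [s_(j+1) ... s_k]
    and [r_0 = 1].  The [k + 1] factors belong to the finite set of elements of
    [A] of the form [r^-1 s r'], and [f] maps the basis vectors of [Z^m] to the
    elements of this set. *)
Lemma schreier_coordinates (G : groupType) (S : set G)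
    (A : abelian_subgroup G) :
  finite_set S -> finite_index A ->
  exists m : nat, exists f : {additive 'rV[int]_m -> elements A},
  forall k (x : elements A), has_word S (incl x) k ->
  exists2 w : 'rV[int]_m, (forall i, (`|w 0 i| <= k.+1%:Z)%R) & f w = x.
Proof.
move=> finS [R RP].
have [L LE] : exists L : seq G, letters S = [set` L].
  by apply/finite_seqP; rewrite finite_setU; split=> //; apply: finite_image.
pose gens : seq G :=
  [seq r^-1 * y | r <- 1 :: R, y <- [seq s * r | s <- 1 :: L, r <- 1 :: R]].
pose U : seq (elements A) :=
  pmap (insub : G -> option {x : G | x \in carrier A}) gens.
have UP r s r' z : r \in 1 :: R -> s \in 1 :: L -> r' \in 1 :: R ->
    incl z = r^-1 * (s * r') -> z \in U.
  move=> rR sL rR' zE; rewrite mem_pmap_sub -[val z]/(incl z) zE.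
  apply/allpairsP; exists (r, s * r'); split=> //.
  by apply/allpairsP; exists (s, r').
pose t (i : 'I_(size U)) := tnth (in_tuple U) i.
exists (size U), (int_comb t).
have gen_box z : z \in U ->
    exists2 w : 'rV[int]_(size U),
      (forall i, (`|w 0 i| <= 1%:Z)%R) & int_comb t w = z.
  move=> zU; have [i zE] : exists i, z = t i.
    by have /seq_tnthP[i ->] := zU; exists i.
  exists (delta_mx 0 i); last by rewrite int_comb_delta zE.
  by move=> j; rewrite mxE eqxx; case: eqP.
(* The induction on the word involves all cosets; r is the representative of
   the coset of p. *)
suff coords r k (p : G) (x : elements A) : has_word S p k -> r \in 1 :: R ->
    incl x = r^-1 * p ->
    exists2 w : 'rV[int]_(size U),
      (forall i, (`|w 0 i| <= k.+1%:Z)%R) & int_comb t w = x.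
  by move=> k x xk; apply: (coords 1 k (incl x)); rewrite ?mem_head //
    invg1 mul1g.
elim: k p r x => [|k IHk] p r x.
  case=> -[|? ?] [] //= _ _; rewrite big_nil => <- rR xE.
  by apply: (gen_box x); apply: (UP r 1 1); rewrite ?mem_head // xE !mulg1.
case=> -[|s v] [] //= lv [szv] <-; rewrite big_cons.
set q := \prod_(y <- v) y => rR xE.
have [r' rR' /incl_surj[y yE]] := RP q.
have qk : has_word S q k.
  by exists v; split=> // a av; apply: lv; rewrite inE av orbT.
have {}rR' : r' \in 1 :: R by rewrite inE rR' orbT.
have [w wk wE] := IHk _ _ _ qk rR' yE.
have [|w' wk' wE'] := gen_box (x - y)%R.
  apply: (UP r s r') => //.
    rewrite inE; apply/orP; right.
    by have := lv s (mem_head _ _); rewrite LE.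
  by rewrite inclB xE yE invgM invgK -!mulgA (mulgA q) mulgV mul1g.
exists (w' + w)%R; last by rewrite raddfD /= wE wE' subrK.
move=> i; rewrite mxE (le_trans (ler_normD _ _)) // -[k.+2]add1n PoszD.
by rewrite lerD.
Qed.

(** * Word length and growth *)

Lemma word_length1 (G : groupType) (S : set G) : word_length S 1 = 0%N.
Proof.
apply/eqP; rewrite -leqn0; apply: word_length_le.
by exists [::]; split=> //; rewrite big_nil.
Qed.

Lemma word_lengthM (G : groupType) (S : set G) (x y : G) :
  generates S ->
  (word_length S (x * y) <= word_length S x + word_length S y)%N.
Proof.
move=> genS; apply: word_length_le.
have [v [vS <- vx]] := word_lengthP x genS.
have [w [wS <- wy]] := word_lengthP y genS.
exists (v ++ w); split; last 2 first.
- by rewrite size_cat.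
- by rewrite big_cat vx wy.
by move=> a; rewrite mem_cat => /orP[/vS|/wS].
Qed.

Lemma word_length_comb (G : groupType) (S : set G) (A : abelian_subgroup G)
    (d : nat) (b : 'I_d -> elements A) (c : 'I_d -> nat) :
  generates S ->
  (word_length S (incl (\sum_i b i *+ c i)%R) <=
   \sum_i c i * word_length S (incl (b i)))%N.
Proof.
move=> genS; pose bounded (z : elements A) n := (word_length S (incl z) <= n)%N.
have boundedD x n y p :
    bounded x n -> bounded y p -> bounded (x + y)%R (n + p)%N.
  move=> xn yp; rewrite /bounded inclD.
  exact: leq_trans (word_lengthM _ _ genS) (leq_add xn yp).
apply: (big_ind2 bounded) => // [|i _].
  by rewrite /bounded incl0 word_length1.
elim: (c i) => [|n IHn]; first by rewrite mulr0n /bounded incl0 word_length1.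
by rewrite mulrS mulSn; apply: boundedD IHn; apply: leqnn.
Qed.

Lemma growth_le_seq (G : groupType) (S U : set G) (n : nat) (Y : seq G) :
  (forall x, U x -> (word_length S x <= n)%N -> x \in Y) ->
  (growth S U n <= size Y)%N.
Proof.
move=> UY; have finU : finite_set [set x | U x /\ (word_length S x <= n)%N].
  apply: (@sub_finite_set _ _ [set` Y]); last exact: finite_seq.
  by move=> x [Ux xn]; apply: UY.
apply: uniq_leq_size; first exact: fset_uniq.
by move=> x; rewrite in_fset_set // inE => -[Ux xn]; apply: UY.
Qed.

Lemma growth_ge_injective (G : groupType) (S U : set G) (n : nat)
    (T : finType) (h : T -> G) :
  finite_set S -> generates S -> injective h ->
  (forall c, U (h c) /\ (word_length S (h c) <= n)%N) ->
  (#|T| <= growth S U n)%N.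
Proof.
move=> finS genS h_inj hU; rewrite -(size_codom h).
apply: uniq_leq_size; first by apply/injectiveP.
move=> _ /codomP[c ->]; rewrite in_fset_set ?inE; first exact: hU.
by apply: sub_finite_set (finite_ball n finS genS) => x [].
Qed.

Lemma subgroup_sum (Z : zmodType) (B : set Z) (d : nat) (b : 'I_d -> Z)
    (c : 'I_d -> nat) :
  B 0%R -> (forall x y, B x -> B y -> B (x - y)%R) -> (forall i, B (b i)) ->
  B (\sum_i b i *+ c i)%R.
Proof.
move=> B0 BB Bb.
have BD x y : B x -> B y -> B (x + y)%R.
  move=> Bx By; rewrite -[y]opprK -[(- y)%R]sub0r.
  by apply: (BB) => //; apply: BB.
apply: (big_ind B) => // i _; elim: (c i) => [|n IHn]; first by rewrite mulr0n.
by rewrite mulrS; apply: BD.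
Qed.

(** * Conjugacy classes *)

(** The subgroup of the commutators [a (g a g^-1)^-1] for those [a] in [A] such
    that [g a g^-1] is in [A]; in additive notation, [u] is [a] and [v] is
    [g a g^-1]. *)
Definition twisted_differences (G : groupType) (A : abelian_subgroup G)
    (g : G) : set (elements A) :=
  [set z | exists u v : elements A,
     g * incl u * g^-1 = incl v /\ z = (u - v)%R].

Lemma twisted_differencesB (G : groupType) (A : abelian_subgroup G) (g : G)
    (x y : elements A) :
  twisted_differences g x -> twisted_differences g y ->
  twisted_differences g (x - y)%R.
Proof.
move=> [u [v [uv ->]]] [u' [v' [uv' ->]]]; exists (u - u')%R, (v - v')%R.
split; last by rewrite !opprD !opprK addrACA.
by rewrite !inclB -uv -uv' !invgM invgK !mulgA mulgVK.
Qed.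

Lemma twisted_differences0 (G : groupType) (A : abelian_subgroup G) (g : G) :
  twisted_differences g (0 : elements A)%R.
Proof. by exists 0%R, 0%R; rewrite incl0 mulg1 mulgV subr0. Qed.

Lemma twisted_difference_conj (G : groupType) (A : abelian_subgroup G) (g : G)
    (z : elements A) :
  twisted_differences g z -> conjugacy_class g (incl z * g).
Proof.
move=> [u [v [uv ->]]]; exists (incl u) => //.
by rewrite inclB -uv !invgM invgK !mulgA mulgVK.
Qed.

(** [R] represents the cosets of the subgroup of all [a] in [A] with
    [g a g^-1] in [A], which has finite index.  For [h = r a] with such an [a],
    [h g h^-1] is the conjugate by [r] of [a g a^-1 = (a (g a g^-1)^-1) g]. *)
Lemma conjugacy_class_cover (G : groupType) (A : abelian_subgroup G) (g : G) :
  finite_index A ->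
  exists R : seq G, forall x, conjugacy_class g x ->
    exists2 r, r \in R & exists2 z : elements A,
      twisted_differences g z & x = r * (incl z * g) * r^-1.
Proof.
move=> finA; have groupA := carrier_group A.
have groupAg : group_closed (mem [set x | carrier A (g * x * g^-1)]).
  split; first by apply/mem_set; rewrite /= mulg1 mulgV; apply: subgroup_mem1.
  move=> x y /set_mem /= Ax /set_mem /= Ay; apply/mem_set => /=.
  have -> : g * (x / y) * g^-1 = (g * x * g^-1) * (g * y * g^-1)^-1.
    by rewrite !invgM invgK !mulgA mulgVK.
  by apply: subgroup_memM => //; apply: subgroup_memV.
have [R RP] := finite_indexI groupA groupAg finA (finite_index_conj g finA).
exists R => _ [h _ <-].
have [r rR [/= /incl_surj[u uE] /incl_surj[v vE]]] := RP h.
exists r => //; exists (u - v)%R; first by exists u, v; rewrite uE vE.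
by rewrite inclB uE vE !invgM !invgK !mulgA mulgV mul1g mulgVK mulgK.
Qed.

Theorem theorem3p8 (G : groupType) (S : set G) (finS : finite_set S)
    (genS : generates S) (vabG : virtually_abelian G) (g : G) :
  polynomial_growth S (conjugacy_class g).
Proof.
have [A0 [groupA0 abA0 finA0]] := vabG.
pose A := AbelianSubgroup groupA0 abA0.
have finA : finite_index A by apply: finite_left_cosets_index.
have [m [f fP]] := schreier_coordinates finS finA.
have [R RP] := conjugacy_class_cover g finA.
have [d [[b [Bb b_inj]] [C CP]]] :=
  subgroup_rank f (@twisted_differencesB G A g).
exists d; split.
  (* If r z g r^-1 has length at most n, then z has length at most n + e, and
     the vector above z has entries at most n + e + 1. *)
  pose l := word_length S; pose e := (l g^-1 + \sum_(r <- R) (l r^-1 + l r))%N.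
  exists (size R * C + e.+2)%N; first by rewrite addnS.
  move=> n; have [Y Ysize YP] := CP (n + e).+1.
  apply: (leq_trans (n := (size R * size Y)%N)).
    rewrite -(size_allpairs (fun r z => r * (incl z * g) * r^-1)).
    apply: growth_le_seq => _ /RP[r rR [z Bz ->]] xn.
    apply: allpairs_f => //.
    have [|w wn wz] := fP (word_length S (incl z)) z; first exact: word_lengthP.
    rewrite -wz; apply: YP; last by rewrite wz.
    move=> i; apply: le_trans (wn i) _; rewrite lez_nat ltnS.
    have zE : incl z = r^-1 * (r * (incl z * g) * r^-1) * r * g^-1.
      by rewrite !mulgA mulVg mul1g mulgVK mulgK.
    have re : (l r^-1 + l r <= \sum_(r <- R) (l r^-1 + l r))%N.
      by rewrite (big_rem r rR) leq_addr.
    have lM (x y : G) : (l (x * y)%g <= l x + l y)%N := word_lengthM x y genS.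
    rewrite zE; move: xn; rewrite -/l; set x := r * _ * _ => xn.
    apply: leq_trans (lM _ _) _; rewrite /e addnCA addnC leq_add2l.
    apply: leq_trans (lM _ _) _.
    apply: leq_trans (leq_add (lM _ _) (leqnn _)) _.
    by rewrite addnAC addnC leq_add.
  apply: leq_trans (leq_addr _ _); set l' := (size R * C + e.+2)%N.
  have : ((n + e).+2 ^ d <= (l' * n + l') ^ d)%N.
    by apply: leq_exp_base; rewrite /l'; nia.
  move=> le_exp; apply: leq_trans (leq_mul (leq_addr _ _) le_exp).
  by rewrite -mulnA leq_mul.
(* The elements (sum of b_i c_i) g with 0 <= c_i <= n are in the class, and
   their lengths are at most D n + l(g). *)
pose D := (\sum_i word_length S (incl (b i)))%N.
exists (D + word_length S g).+1 => // n.
pose h (c : {ffun 'I_d -> 'I_n.+1}) := incl (\sum_i b i *+ c i)%R * g.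
apply: leq_trans (leq_addr _ _); apply: leq_trans (leq_pmull _ _) => //.
apply: (leq_trans (n := #|{ffun 'I_d -> 'I_n.+1}|)).
  by rewrite card_ffun !card_ord leq_exp_base.
apply: (growth_ge_injective (h := h)) => //.
  move=> c c' /mulIg/incl_inj eqc.
  have /b_inj/ffunP cc' : (\sum_i b i *+ [ffun i => c i : nat] i =
      \sum_i b i *+ [ffun i => c' i : nat] i)%R.
    by under eq_bigr do rewrite ffunE; under [RHS]eq_bigr do rewrite ffunE.
  by apply/ffunP => i; apply: val_inj; have := cc' i; rewrite !ffunE.
move=> c; split.
  apply: twisted_difference_conj.
  apply: subgroup_sum => //; first exact: twisted_differences0.
  exact: twisted_differencesB.
apply: leq_trans (word_lengthM _ _ genS) _.
have : (word_length S (incl (\sum_i b i *+ c i)%R) <= D * n)%N.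
  apply: leq_trans (word_length_comb _ _ genS) _.
  rewrite /D big_distrl leq_sum //= => i _.
  by rewrite mulnC leq_mul // -ltnS.
move=> len; apply: leq_trans (leq_add len (leqnn _)) _.
move: {len} D (word_length S g) => p q; nia.
Qed.
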